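(* Let $q=2^m$ with $m\ge 3$ an integer, and let $G=\langle a,b\rangle\le\mathfrak{S}_q$ be the group described in the context. Let $f_1$ be a permutation group polynomial over $\mathbb{F}_q$ corresponding to $G$, with permutation polynomial tuple $\underline{\beta}_{f_1}=(\beta_0,\beta_1,\ldots,\beta_{q-1})\in\mathfrak{S}_q^q$. Then there are $q!$ permutation group polynomials equivalent to $f_1$.
   Context: $\mathfrak{S}_q$ is the symmetric group on $\mathbb{F}_q=\{c_0,\ldots,c_{q-1}\}$ (a fixed enumeration); permutations are composed right to left. The permutations are $a=(c_0,c_1)(c_2,c_3)\cdots(c_{q-2},c_{q-1})$ and $$b=(c_{\frac q2-2},c_{\frac q2-4},\ldots,c_2,c_0,\;c_{\frac q2},c_{\frac q2+2},\ldots,c_{q-4},c_{q-2})\,(c_1,c_3,\ldots,c_{\frac q2-1},\;c_{q-1},c_{q-3},\ldots,c_{\frac q2+1}),$$ a product of two disjoint cycles of length $\frac q2$ (in each cycle, indices move in steps of $2$ within each of the two runs). It is known that $|a|=2$, $|b|=\frac q2$, $ab=b^{-1}a$, that $G=\langle a,b\rangle=\{b^ja^i: 0\le j\le \frac q2-1,\ 0\le i\le 1\}$ has order $q$, and that no non-identity element of $G$ has a fixed point. Functions $\mathbb{F}_q^2\to\mathbb{F}_q$ are identified with polynomials in $\mathbb{F}_q[X_1,X_2]$ of degree less than $q$ in each variable (these are the polynomials being counted). A bivariate polynomial $f$ is a local permutation polynomial (LPP) if for every $c\in\mathbb{F}_q$ both $x\mapsto f(x,c)$ and $x\mapsto f(c,x)$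 are bijections of $\mathbb{F}_q$. Bivariate LPPs are in bijection with permutation polynomial tuples, i.e. tuples $\underline{\beta}_f=(\beta_0,\ldots,\beta_{q-1})\in\mathfrak{S}_q^q$ such that $\beta_i\beta_j^{-1}$ has no fixed point for $i\ne j$, via $f(x,\beta_i(x))=c_i$ for all $x\in\mathbb{F}_q$ and all $i$. An LPP is a permutation group polynomial if the entries of its tuple form a subgroup of $\mathfrak{S}_q$, and it then corresponds to that subgroup. Two LPPs $f,g$ with tuples $(\beta_0,\ldots,\beta_{q-1})$ and $(\gamma_0,\ldots,\gamma_{q-1})$ are equivalent if there exist $\lambda,\sigma\in\mathfrak{S}_q$ with $\lambda\beta_i\sigma=\gamma_i$ for all $0\le i\le q-1$. *)

(* Defs.v *)
From HB Require Import structures.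
From mathcomp Require Import all_boot all_order all_algebra all_fingroup.
From mathcomp Require Import mpoly.

Set Implicit Arguments.
Unset Strict Implicit.
Unset Printing Implicit Defensive.

(* The [undup] only serves to make the definition total. *)
Definition cycle_perm (T : finType) (s : seq T) : {perm T} :=
  perm (can_inj (prev_next (undup_uniq s))).

Section LocalPermutationPolynomials.
Local Open Scope ring_scope.
Variable F : finFieldType.
Implicit Types (f g : {mpoly F[2]}) (beta gamma : 'I_#|F| -> {perm F}).

Definition eval2 f (x y : F) : F := f.@[tnth [tuple x; y]].

(* Every function F ^ 2 -> F is induced by exactly one reduced polynomial. *)
Definition reduced f : Prop :=
  forall n : 'X_{1..2}, n \in msupp f -> forall i : 'I_2, (n i < #|F|)%N.

Definition is_LPP f : Prop :=
  reduced f /\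
  forall z : F, bijective (fun x => eval2 f x z) /\
                bijective (fun x => eval2 f z x).

Variable c : #|F|.-tuple F.

(* When [c] enumerates F, an LPP has exactly one such tuple: see            *)
(* [LPP_tuple_exists] and [LPP_tuple_unique].                               *)
Definition is_tuple_of f beta : Prop :=
  forall (i : 'I_#|F|) (x : F), eval2 f x (beta i x) = tnth c i.

(* A set of permutations is a subgroup for left-to-right composition (the   *)
(* product of {perm F}) iff it is one for right-to-left composition.        *)
Definition group_polynomial_of f (G : {group {perm F}}) : Prop :=
  is_LPP f /\
  exists beta, is_tuple_of f beta /\ [set beta i | i : 'I_#|F|] = G.

Definition is_group_polynomial f : Prop :=
  exists G : {group {perm F}}, group_polynomial_of f G.

(* lam beta_i sig = gamma_i, composed right to left. *)
Definition LPP_equiv f g : Prop :=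
  exists beta gamma,
    [/\ is_tuple_of f beta, is_tuple_of g gamma &
        exists lam sig : {perm F},
          forall (i : 'I_#|F|) (x : F), gamma i x = lam (beta i (sig x))].

Lemma LPP_tuple_unique f beta gamma : is_LPP f ->
  is_tuple_of f beta -> is_tuple_of f gamma -> beta =1 gamma.
Proof.
case=> _ bijf tb tg i; apply/permP => x.
by apply: (bij_inj (bijf x).2); rewrite tb tg.
Qed.

Lemma LPP_tuple_exists f : uniq c -> is_LPP f ->
  exists beta, is_tuple_of f beta.
Proof.
move=> uc [_ bijf].
have ex (i : 'I_#|F|) (x : F) : exists y, eval2 f x y == tnth c i.
  by have [h _ hK] := (bijf x).2; exists (h (tnth c i)); rewrite hK.
pose b i x := xchoose (ex i x).
have bE i x : eval2 f x (b i x) = tnth c i by apply/eqP/(xchooseP (ex i x)).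
have b_inj i : injective (b i).
  move=> x y bxy; apply: (bij_inj (bijf (b i x)).1).
  by rewrite bE bxy bE.
by exists (fun i => perm (b_inj i)) => i x; rewrite permE.
Qed.

End LocalPermutationPolynomials.

Section TheGroup.
Local Open Scope ring_scope.
Variables (F : finFieldType) (c : #|F|.-tuple F).
Let q := #|F|.

Definition elt (k : nat) : F := nth 0 c k.

(* (c_0, c_1) (c_2, c_3) ... (c_(q-2), c_(q-1)) *)
Definition perm_a : {perm F} :=
  (\prod_(k < q %/ 2) (tperm (elt (2 * k)) (elt (2 * k + 1)) : {perm F}))%g.

(* q/2 - 2, q/2 - 4, ..., 2, 0, q/2, q/2 + 2, ..., q - 4, q - 2 *)
Definition b_even : seq nat :=
  rev [seq (2 * k)%N | k <- iota 0 (q %/ 4)]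
  ++ [seq (q %/ 2 + 2 * k)%N | k <- iota 0 (q %/ 4)].

(* 1, 3, ..., q/2 - 1, q - 1, q - 3, ..., q/2 + 1 *)
Definition b_odd : seq nat :=
  [seq (2 * k + 1)%N | k <- iota 0 (q %/ 4)]
  ++ rev [seq (q %/ 2 + 2 * k + 1)%N | k <- iota 0 (q %/ 4)].

Definition perm_b : {perm F} :=
  (cycle_perm (map elt b_even) * cycle_perm (map elt b_odd))%g.

Definition group_ab : {group {perm F}} := <<[set perm_a; perm_b]>>%G.

End TheGroup.

(* Main.v *)
Require Import Defs.
From HB Require Import structures.
From mathcomp Require Import all_boot all_order all_algebra all_fingroup.
From mathcomp Require Import mpoly.

(* The entries of the tuple of an LPP are sharply transitive in the index, so *)
(* G is a regular permutation group.  If lam beta_i sig runs through a group, *)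
(* some lam beta_i0 sig is 1, so the tuple is the conjugate by lam of a       *)
(* translate h beta_i with h in G.  The conjugating permutation is determined *)
(* up to the centraliser of G, which is again regular, so it can be chosen in *)
(* exactly one way to fix a given point x0.  This leaves q (q - 1)! = q!      *)
(* tuples.                                                                    *)

Set Implicit Arguments.
Unset Strict Implicit.
Unset Printing Implicit Defensive.

(** Reduced polynomials correspond to functions on pairs, and LPPs to sharply transitive tuples
    ([reduced_eval2_inj], [LPP_of_tuple], [LPP_of_tuple_unique]), so it suffices to count tuples.
    The tuples in question are parametrised by pairs of [h] in [G] and [l] fixing [x0]: every pair
    gives one ([normal_tuple_group], [normal_tuple_equiv]), every tuple arises
    ([equiv_normal_tuple]), and from one pair only ([conj_tuple_inj]). Behind the last two facts lie
    [regular_cent_trans] and [trans_cent_fix]. *)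

(** * Centraliser of a regular permutation group *)

Section RegularGroup.
Local Open Scope group_scope.
Variables (T : finType) (G : {group {perm T}}).
Hypothesis G_trans : forall x y : T, exists2 g, g \in G & g x = y.

Lemma trans_cent_fix (mu : {perm T}) (x : T) :
  mu \in 'C(G) -> mu x = x -> mu = 1.
Proof.
move=> /centP Cmu mux; apply/permP => y; rewrite perm1.
have [g Gg <-] := G_trans x y.
by rewrite -permM -(Cmu g Gg) permM mux.
Qed.

Hypothesis G_free :
  forall (g h : {perm T}) (x : T), g \in G -> h \in G -> g x = h x -> g = h.

(** Identify [T] with [G] by letting [y] correspond to the unique [r y] in [G] sending [x] to [y].
    Then [G] acts by multiplication on one side, and [y |-> r y z] comes from multiplication on the
    other side, so the two commute. *)
Lemma regular_cent_trans (x z : T) : exists2 mu, mu \in 'C(G) & mu x = z.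
Proof.
have ex y : exists g, (g \in G) && (g x == y).
  by have [g Gg <-] := G_trans x y; exists g; rewrite Gg eqxx.
pose r y := xchoose (ex y).
have rG y : r y \in G by have /andP[] := xchooseP (ex y).
have rE y : r y x = y by have /andP[_ /eqP] := xchooseP (ex y).
have r_inj : injective (fun y => r y z).
  by move=> y y' /(G_free (rG y) (rG y')) eq_r; rewrite -(rE y) eq_r rE.
exists (perm r_inj).
  apply/centP => g Gg; apply/permP => y; rewrite !permM !permE -permM.
  congr (fun_of_perm _ z).
  by apply: (G_free (x := x)) => //; rewrite ?groupM // permM !rE.
by rewrite permE (_ : r x = 1) ?perm1 //; apply: (G_free (x := x)); rewrite ?rE ?perm1.
Qed.

End RegularGroup.

(** * Reduced polynomials and functions of two variables *)

Section Reduced.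
Import GRing.Theory.
Local Open Scope ring_scope.
Variable F : finFieldType.
Implicit Types (f g : {mpoly F[2]}).
Let q := #|F|.

Lemma horner_inj_card (p r : {poly F}) : (size p <= q)%N -> (size r <= q)%N ->
  (forall x, p.[x] = r.[x]) -> p = r.
Proof.
move=> sp sr eq_pr; apply/eqP; rewrite -subr_eq0; apply: contraT => nz.
have := @max_poly_roots F (p - r) (enum F) nz; rewrite enum_uniq -cardE.
have -> : all (root (p - r)) (enum F).
  by apply/allP => x _; rewrite /root hornerD hornerN eq_pr subrr.
move=> /(_ isT isT); rewrite ltnNge (leq_trans (size_polyD _ _)) //.
by rewrite size_polyN geq_max sp sr.
Qed.

Definition mnm2 (i j : nat) : 'X_{1..2} := [multinom [tuple i; j]].

(** Coefficient arrays form a finite type, which makes reduced polynomials countable. *)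
Definition mpoly2 (A : {ffun 'I_q * 'I_q -> F}) : {mpoly F[2]} :=
  \sum_ij A ij *: 'X_[mnm2 ij.1 ij.2].

Lemma mnm2_eta (n : 'X_{1..2}) : n = mnm2 (n ord0) (n ord_max).
Proof.
apply/mnmP => i; rewrite [RHS]multinomE (tnth_nth 0%N) /=.
by case: i => [[|[|]]] //= lti; congr (n _); apply: val_inj.
Qed.

Lemma mnm2_inj i j i' j' : mnm2 i j = mnm2 i' j' -> (i = i') /\ (j = j').
Proof.
move=> /mnmP e; have := e ord0; have := e ord_max.
by rewrite !multinomE !(tnth_nth 0%N).
Qed.

Lemma mcoeff_mpoly2 A (i j : 'I_q) : (mpoly2 A)@_(mnm2 i j) = A (i, j).
Proof.
rewrite /mpoly2 raddf_sum /= (bigD1 (i, j)) //= mcoeffZ mcoeffX eqxx mulr1.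
rewrite big1 ?addr0 // => -[i' j'] /= ne; rewrite mcoeffZ mcoeffX.
case: eqP => [/mnm2_inj[/val_inj e1 /val_inj e2]|]; last by rewrite mulr0.
by rewrite e1 e2 eqxx in ne.
Qed.

Lemma reduced_mpoly2 A : reduced (mpoly2 A).
Proof.
move=> n; rewrite mcoeff_msupp => nz k.
suff [ij ->] : exists ij : 'I_q * 'I_q, n = mnm2 ij.1 ij.2.
  by rewrite multinomE (tnth_nth 0%N); case: k => [[|[|]]] //=.
suff /existsP[ij /eqP->] : [exists ij : 'I_q * 'I_q, n == mnm2 ij.1 ij.2] by exists ij.
apply: contraNT nz => /existsPn no; apply/eqP.
rewrite /mpoly2 raddf_sum /= big1 // => ij _; rewrite mcoeffZ mcoeffX.
by rewrite eq_sym (negPf (no ij)) mulr0.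
Qed.

Lemma reducedE f : reduced f ->
  f = mpoly2 [ffun ij : 'I_q * 'I_q => f@_(mnm2 ij.1 ij.2)].
Proof.
move=> rf; apply/mpolyP => n; set g := mpoly2 _.
have out (h : {mpoly F[2]}) : reduced h -> ~~ ((n ord0 < q) && (n ord_max < q))%N -> h@_n = 0.
  move=> rh; apply: contraNeq; rewrite -mcoeff_msupp => nh.
  by apply/andP; split; exact: (rh n nh).
have [/andP[lt0 lt1]|no] := boolP ((n ord0 < q) && (n ord_max < q))%N; last first.
  by rewrite !out //; apply: reduced_mpoly2.
by rewrite (mnm2_eta n) (mcoeff_mpoly2 _ (Ordinal lt0) (Ordinal lt1)) ffunE.
Qed.

Lemma eval2_mpoly2 A x y :
  eval2 (mpoly2 A) x y = \sum_(i < q) (\sum_(j < q) A (i, j) * y ^+ j) * x ^+ i.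
Proof.
rewrite /eval2 /mpoly2 raddf_sum /=.
under [RHS]eq_bigr do rewrite mulr_suml.
rewrite [RHS]pair_bigA /=; apply: eq_bigr => -[i j] _ /=.
rewrite mevalZ mevalX !big_ord_recl big_ord0 !multinomE !(tnth_nth 0%N) /=.
by rewrite !(tnth_nth 0) /= mulr1 -mulrA [y ^+ _ * _]mulrC.
Qed.

(** A polynomial of degree below q is determined by its q values. This is used twice: in [x] for
    each fixed [y], then in [y] for each coefficient. *)
Lemma eval2_mpoly2_inj A B :
  eval2 (mpoly2 A) =2 eval2 (mpoly2 B) -> A = B.
Proof.
(* [insub] extends [a] to all of [nat]; the default 0 is never reached below q. *)
have sumE (a : 'I_q -> F) x :
    \sum_i a i * x ^+ i = (\poly_(i < q) (if insub i is Some k then a k else 0)).[x].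
  by rewrite horner_poly; apply: eq_bigr => i _; rewrite valK.
have sum_inj (a b : 'I_q -> F) :
    (forall x, \sum_i a i * x ^+ i = \sum_i b i * x ^+ i) -> a =1 b.
  move=> e i.
  have := @horner_inj_card _ _ (size_poly q _) (size_poly q _)
            (fun x => etrans (esym (sumE a x)) (etrans (e x) (sumE b x))).
  by move=> /(congr1 (fun p : {poly F} => p`_i)); rewrite !coef_poly ltn_ord valK.
move=> eqAB; apply/ffunP => -[i j].
have rows y := sum_inj _ _ (fun x => etrans (esym (eval2_mpoly2 A x y))
                             (etrans (eqAB x y) (eval2_mpoly2 B x y))) i.
exact: (sum_inj (fun j => A (i, j)) (fun j => B (i, j)) rows).
Qed.

Lemma reduced_eval2_inj f g :
  reduced f -> reduced g -> eval2 f =2 eval2 g -> f = g.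
Proof.
move=> /reducedE-> /reducedE-> /eval2_mpoly2_inj eqfg.
by rewrite eqfg.
Qed.

(** By counting: evaluation is injective from coefficient arrays to functions, and both sets have
    the same size. *)
Lemma reduced_interpolation (phi : F -> F -> F) :
  exists2 f, reduced f & eval2 f =2 phi.
Proof.
pose ev A : {ffun F * F -> F} := [ffun xy => eval2 (mpoly2 A) xy.1 xy.2].
have ev_inj : injective ev.
  move=> A B /ffunP eAB; apply: eval2_mpoly2_inj => x y.
  by have := eAB (x, y); rewrite !ffunE.
have [|h _ hK] := inj_card_bij ev_inj.
  by rewrite !card_ffun !card_prod !card_ord.
exists (mpoly2 (h [ffun xy => phi xy.1 xy.2])); first exact: reduced_mpoly2.
by move=> x y; have /ffunP/(_ (x, y)) := hK [ffun xy => phi xy.1 xy.2]; rewrite !ffunE.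
Qed.

End Reduced.

(** * LPPs and sharply transitive tuples *)

Section Tuples.
Variables (F : finFieldType) (c : #|F|.-tuple F).
Hypothesis uniq_c : uniq c.
Implicit Types (f g : {mpoly F[2]}) (beta : 'I_#|F| -> {perm F}).

(** The graph of [beta i] lies in the level set of [f] at [c_i], and distinct level sets are
    disjoint. *)
Lemma tuple_of_inj f beta x : is_tuple_of c f beta -> injective (beta^~ x).
Proof.
by move=> tf i j eq_ij; apply/(tuple_uniqP c uniq_c); rewrite -!(tf _ x) eq_ij.
Qed.

Lemma sharp_tuple_surj beta x y :
  (forall x, injective (beta^~ x)) -> exists i, beta i x = y.
Proof.
move=> /(_ x)/inj_card_bij; rewrite card_ord => /(_ (leqnn _))[h _ hK].
by exists (h y); apply: hK.
Qed.

(** The graphs of the [beta i] partition the plane; [f] takes the value [c_i] on the i-th graph. *)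
Lemma LPP_of_tuple beta : (forall x, injective (beta^~ x)) ->
  exists f, is_LPP f /\ is_tuple_of c f beta.
Proof.
move=> sharp; have surj x y := sharp_tuple_surj x y sharp.
have ex x y : exists i, beta i x == y by have [i <-] := surj x y; exists i.
have [f rf fE] :=
  reduced_interpolation (fun x y => tnth c (xchoose (ex x y))).
have tf : is_tuple_of c f beta.
  move=> i x; rewrite fE; congr (tnth c _).
  exact/(sharp x)/eqP/(xchooseP (ex x (beta i x))).
exists f; split=> //; split=> // z; split; apply: injF_bij => x y.
  (* Equal values at [(x, z)] and [(y, z)] put both points on one graph, and [beta i] is
     injective. *)
  have [i <-] := surj x z; have [j eji] := surj y (beta i x).
  rewrite tf -eji tf => /(tuple_uniqP c uniq_c) eij; move: eji.
  by rewrite -eij => /perm_inj.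
have [i <-] := surj z x; have [j <-] := surj z y.
by rewrite !tf => /(tuple_uniqP c uniq_c)->.
Qed.

Lemma LPP_of_tuple_unique f g beta : is_LPP f -> is_LPP g ->
  is_tuple_of c f beta -> is_tuple_of c g beta -> f = g.
Proof.
move=> [rf _] [rg _] tf tg; apply: reduced_eval2_inj => // x y.
have [i <-] := sharp_tuple_surj x y (fun x => tuple_of_inj (x := x) tf).
by rewrite tf tg.
Qed.

End Tuples.

(** * Counting the equivalent group tuples *)

Section EquivalentTuples.
Local Open Scope group_scope.
Variables (F : finFieldType) (c : #|F|.-tuple F) (f1 : {mpoly F[2]}).
Variables (beta : 'I_#|F| -> {perm F}) (G : {group {perm F}}) (x0 : F).
Hypotheses (uniq_c : uniq c) (LPP_f1 : is_LPP f1).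
Hypotheses (tuple_f1 : is_tuple_of c f1 beta) (betaG : [set beta i | i : 'I_#|F|] = G).

Let beta_inG i : beta i \in G. Proof. by rewrite -betaG imset_f. Qed.
Let in_beta g : g \in G -> exists i, g = beta i.
Proof. by rewrite -betaG => /imsetP[i _ ->]; exists i. Qed.
Let sharp x : injective (beta^~ x). Proof. exact: tuple_of_inj tuple_f1. Qed.

Lemma tuple_group_trans x y : exists2 g, g \in G & g x = y.
Proof. by have [i <-] := sharp_tuple_surj x y sharp; exists (beta i). Qed.

Lemma tuple_group_free (g h : {perm F}) x :
  g \in G -> h \in G -> g x = h x -> g = h.
Proof. by move=> /in_beta[i ->] /in_beta[j ->] /sharp->. Qed.

Lemma card_tuple_group : #|G| = #|F|.
Proof.
rewrite -betaG card_imset ?card_ord // => i j eij.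
by apply: (sharp (x := x0)); rewrite /= eij.
Qed.

Definition conj_tuple (hl : {perm F} * {perm F}) : {ffun 'I_#|F| -> {perm F}} :=
  [ffun i => (hl.1 * beta i) ^ hl.2].

(** [Sym [set~ x0]] is the stabiliser of [x0], of order (q - 1)!. *)
Definition normal_tuples : {set {ffun 'I_#|F| -> {perm F}}} :=
  conj_tuple @: setX G (Sym [set~ x0]).

Lemma mem_Sym_fix (l : {perm F}) : (l \in Sym [set~ x0]) = (l x0 == x0).
Proof.
rewrite inE; apply/idP/eqP => [/out_perm-> //|fix0]; first by rewrite !inE eqxx.
by apply/subsetP => x; rewrite !inE; apply: contra => /eqP->; rewrite fix0.
Qed.

Lemma conj_tuple_inj : {in setX G (Sym [set~ x0]) &, injective conj_tuple}.
Proof.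
move=> [h l] [h' l'] /setXP[/= Gh]; rewrite mem_Sym_fix => /eqP l0.
move=> /setXP[/= Gh']; rewrite mem_Sym_fix => /eqP l0' /ffunP eq_t.
(* The position of the identity in the tuple reveals [h]: it is the index [i] with
   [beta i = h^-1]. *)
have eq_h : h = h'.
  have [i hi] := in_beta (groupVr Gh); have := eq_t i; rewrite !ffunE /= -hi.
  rewrite mulgV conj1g => /esym/eqP; rewrite -(conj1g l') => /eqP/conjg_inj.
  by move/eqP; rewrite -eq_mulgV1 => /eqP.
congr pair => //; apply/eqP; rewrite eq_mulgV1; apply/eqP.
(* With [h] known, [l] and [l'] conjugate every element of [G] alike, so [l * l'^-1] centralises
   [G]; it also fixes [x0]. *)
apply: (trans_cent_fix tuple_group_trans (x := x0)); last first.
  by rewrite permM l0 -[in LHS]l0' permK.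
apply/centP => g Gg; apply: commute_sym.
have [i hi] := in_beta (groupM (groupVr Gh) Gg).
have := eq_t i; rewrite !ffunE /= -eq_h -hi mulKVg => eq_g.
by apply/commgP/conjg_fixP; rewrite conjgM eq_g conjgK.
Qed.

Lemma card_normal_tuples : #|normal_tuples| = #|F|`!.
Proof.
rewrite card_in_imset; last exact: conj_tuple_inj.
have q_gt0 : 0 < #|F| by apply/card_gt0P; exists x0.
rewrite cardsX card_tuple_group card_Sym cardsC1.
by rewrite -[in RHS](prednK q_gt0) factS prednK.
Qed.

Lemma normal_tuple_sharp t x : t \in normal_tuples -> injective (fun i => t i x).
Proof.
case/imsetP => -[h l] _ -> i j; rewrite !ffunE /= !conjgE !permM.
by move=> /perm_inj/sharp.
Qed.

(** Translating by [h] in [G] only permutes [G], so the entries fill the conjugate of [G] by [l]. *)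
Lemma normal_tuple_group t : t \in normal_tuples ->
  exists K : {group {perm F}}, [set t i | i : 'I_#|F|] = K.
Proof.
case/imsetP => -[h l] /setXP[/= Gh _] ->; exists (G :^ l)%G => /=.
rewrite -(lcoset_id Gh) -lcosetE -betaG /conjugate /lcoset -!imset_comp.
by apply: eq_imset => i /=; rewrite ffunE.
Qed.

Lemma normal_tuple_equiv t g :
  t \in normal_tuples -> is_tuple_of c g t -> LPP_equiv c f1 g.
Proof.
case/imsetP => -[h l] _ -> tg; exists beta, (conj_tuple (h, l)); split=> //.
by exists l, (l^-1 * h) => i x; rewrite ffunE /= conjgE !permM.
Qed.

Lemma equiv_normal_tuple g : is_group_polynomial c g -> LPP_equiv c f1 g ->
  exists2 t, t \in normal_tuples & is_tuple_of c g t.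
Proof.
case=> K [Lg [gam' [tgam' gamK]]] [beta' [gam [tbeta' tgam [l [s gamE']]]]].
have eq_gam := LPP_tuple_unique Lg tgam' tgam.
have eq_beta := LPP_tuple_unique LPP_f1 tbeta' tuple_f1.
have gamE i : gam i = s * beta i * l.
  by apply/permP => x; rewrite gamE' eq_beta !permM.
(* The identity entry, at index [i0], expresses [s] through [l] and turns [gam i] into the conjugate
   of [(beta i0)^-1 * beta i] by [l]. *)
have /imsetP[i0 _] : 1 \in [set gam' i | i : 'I_#|F|] by rewrite gamK group1.
rewrite eq_gam gamE => e1.
have sE : s = l^-1 * (beta i0)^-1.
  by apply: (mulIg (beta i0 * l)); rewrite mulgA -e1 -mulgA mulKg mulVg.
(* Replacing [l] by [mu * l] leaves conjugation on [G] unchanged and makes the conjugator fix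
   [x0]. *)
have [mu Cmu mu0] := regular_cent_trans tuple_group_trans tuple_group_free x0 (l^-1 x0).
exists (conj_tuple ((beta i0)^-1, mu * l)).
  apply/imset_f/setXP; split; rewrite /= ?groupV ?beta_inG //.
  by rewrite mem_Sym_fix permM mu0 permKV.
move=> i x; rewrite ffunE /= conjgM.
have -> : ((beta i0)^-1 * beta i) ^ mu = (beta i0)^-1 * beta i.
  apply/conjg_fixP/commgP/commute_sym; move/centP: Cmu; apply.
  by rewrite groupM ?groupV.
by rewrite -(tgam i x) gamE sE conjgE !mulgA.
Qed.

End EquivalentTuples.

(** * From tuples back to polynomials *)

Theorem proposition4p11 (m : nat) (F : finFieldType) (c : #|F|.-tuple F)
    (f1 : {mpoly F[2]}) (beta : 'I_#|F| -> {perm F}) :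
  2 < m -> #|F| = 2 ^ m -> uniq c ->
  group_polynomial_of c f1 (group_ab c) ->
  is_tuple_of c f1 beta ->
  exists s : seq {mpoly F[2]},
    [/\ uniq s,
        forall g : {mpoly F[2]},
          g \in s <-> is_group_polynomial c g /\ LPP_equiv c f1 g
      & size s = #|F|`!].
Proof.
move=> _ _ uc [Lf1 [beta' [tbeta' betaG']]] tbeta.
have betaG : [set beta i | i : 'I_#|F|] = group_ab c.
  rewrite -betaG'; apply: eq_imset.
  exact: LPP_tuple_unique Lf1 tbeta tbeta'.
pose N := normal_tuples beta (group_ab c) 0%R.
(* [P] chooses the LPP of each normal tuple; outside [N] it may be anything, and [f1] serves as
   default. *)
have [t|P NP] := @fin_all_exists _ _
    (fun t f => t \in N -> is_LPP f /\ is_tuple_of c f t).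
  have [Nt|] := boolP (t \in N); last by exists f1.
  have [f Hf] := LPP_of_tuple uc (fun x => normal_tuple_sharp uc tbeta (x := x) Nt).
  by exists f.
exists [seq P t | t in N]; split.
- rewrite map_inj_in_uniq ?enum_uniq // => t t'.
  rewrite !mem_enum => Nt Nt' eqP; apply/ffunP.
  have [Lt tt] := NP t Nt; have [_ tt'] := NP t' Nt'.
  by apply: LPP_tuple_unique Lt tt _; rewrite eqP.
- move=> g; split=> [/imageP[t Nt ->]|[gg eqg]].
    have [Lt tt] := NP t Nt.
    split; last exact: (normal_tuple_equiv tbeta Nt).
    by have [K tK] := normal_tuple_group betaG Nt; exists K; split; last by exists t.
  have [t Nt tt] := equiv_normal_tuple 0%R uc Lf1 tbeta betaG gg eqg.
  have [LP tP] := NP t Nt; have [_ [Lg _]] := gg.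
  by apply/imageP; exists t => //; apply: LPP_of_tuple_unique Lg LP tt tP.
- by rewrite size_map -cardE (card_normal_tuples _ uc tbeta betaG).
Qed.
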